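(* Let $n\ge 1$ and let $\Phi=(\Phi_1,\dots,\Phi_n)$ be the map $$\Phi_i(\mathbf{E}) = A_i^e\,\mathbb{V}_i^e(\mathbf{E}) - L_i^e + \sum_{j=1}^n A_{ij}\,\mathbb{V}_{ij}(\mathbf{E}) - \sum_{j=1}^n L_{ij},\qquad i=1,\dots,n,$$ built from the balance-sheet data $A_i^e,L_i^e,A_{ij},L_{ij}$ and the valuation functions $\mathbb{V}_i^e,\mathbb{V}_{ij}:\mathbb{R}^n\to\mathbb{R}$. If all the valuation functions $\mathbb{V}_i^e$ and $\mathbb{V}_{ij}$ take values in $[0,1]$ and are non-decreasing, then the equation $\mathbf{E}=\Phi(\mathbf{E})$ admits a greatest solution $\mathbf{E}^{\mathrm{max}}$ and a least solution $\mathbf{E}^{\mathrm{min}}$; that is, $\mathbf{E}^{\mathrm{max}}$ and $\mathbf{E}^{\mathrm{min}}$ are solutions, and every solution $\mathbf{E}^*$ satisfies $E_i^{\mathrm{min}}\le E_i^*\le E_i^{\mathrm{max}}$ for all $i$.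
   Context: A financial system of $n$ banks is considered at a fixed time. For each bank $i$, the real numbers $A_i^e\ge 0$ and $L_i^e\ge 0$ are the book values of its external assets and external liabilities. For $i,j\in\{1,\dots,n\}$, $L_{ij}\ge 0$ is the book value of the liability of bank $i$ towards bank $j$, and $A_{ij}\ge 0$ is the book value of the interbank asset of bank $i$ towards bank $j$, with $A_{ji}=L_{ij}$. The external valuation functions $\mathbb{V}_i^e$ and the interbank valuation functions $\mathbb{V}_{ij}$ are functions of the equity vector $\mathbf{E}=(E_1,\dots,E_n)$ (possibly depending on only some of its components). Vector inequalities are componentwise: $\mathbf{x}\le\mathbf{y}$ iff $x_i\le y_i$ for all $i$. A function $\mathbb{V}$ is non-decreasing if $\mathbf{E}\le\mathbf{E}'$ implies $\mathbb{V}(\mathbf{E})\le\mathbb{V}(\mathbf{E}')$. With $m_i=-L_i^e-\sum_j L_{ij}$ and $M_i=A_i^e-L_i^e+\sum_j A_{ij}-\sum_j L_{ij}$, the map $\Phi$ sends $\prod_{i=1}^n[m_i,M_i]$ to itself when the valuation functions take values in $[0,1]$, and solutions $\mathbf{E}$ are sought in this box (equivalently in $\mathbb{R}^n$). *)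

(* Defs.v *)
From mathcomp Require Import all_boot all_order all_algebra.
From mathcomp Require Import boolp classical_sets reals.

Set Implicit Arguments.
Unset Strict Implicit.
Unset Printing Implicit Defensive.

Import Order.TTheory GRing.Theory Num.Theory.

Local Open Scope ring_scope.

(* Vectors of R^n are functions 'I_n -> R, so that the order (_ <= _)%O on
   them is the pointwise order of boolp (FunOrder.lef), i.e. the componentwise
   order on R^n, and Leibniz equality is componentwise equality. *)

Definition nondecreasing_valuation (R : realType) (n : nat)
    (V : ('I_n -> R) -> R) : Prop :=
  {homo V : E E' / (E <= E')%O >-> E <= E'}.

Definition unit_valued (R : realType) (n : nat)
    (V : ('I_n -> R) -> R) : Prop :=
  forall E, 0 <= V E <= 1.

Definition Phi (R : realType) (n : nat)
    (Ae Le : 'I_n -> R) (A L : 'I_n -> 'I_n -> R)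
    (Ve : 'I_n -> ('I_n -> R) -> R) (V : 'I_n -> 'I_n -> ('I_n -> R) -> R)
    (E : 'I_n -> R) : 'I_n -> R :=
  fun i => Ae i * Ve i E - Le i + \sum_(j < n) A i j * V i j E
           - \sum_(j < n) L i j.

(* Main.v *)
(* Knaster-Tarski: the pointwise supremum of the post-fixed points E <= f E of
   a monotone self-map f of the box [m, M] is its greatest fixed point.  The
   least one comes from conjugating f by E |-> - E. *)
Require Import Defs.
From mathcomp Require Import all_boot all_order all_algebra.
From mathcomp Require Import boolp classical_sets reals.

Import Order.TTheory GRing.Theory Num.Theory.

Local Open Scope ring_scope.

(** The bounds concern the values of [f] at every [E], so every post-fixed point lies below [M] and
    no restriction of [f] to the box is needed. *)
Lemma greatest_fixpoint (R : realType) (I : Type) (m M : I -> R)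
    (f : (I -> R) -> I -> R) :
  (forall E, (m <= f E <= M)%O) -> {homo f : E E' / (E <= E')%O} ->
  exists2 G, f G = G & forall E, f E = E -> (E <= G)%O.
Proof.
move=> f_box f_mono.
have m_le E : (m <= f E)%O by case/andP: (f_box E).
have le_M E : (f E <= M)%O by case/andP: (f_box E).
pose S i : set R := [set E i | E in [set E | (E <= f E)%O]]%classic.
pose G i := sup (S i).
have S_sup i : has_sup (S i).
  (* The bottom corner [m] is itself post-fixed, since [f m] lies in the box. *)
  split; first by exists (m i), m => //; exact: m_le.
  exists (M i) => _ [E /= EfE <-].
  by have /lefP := le_trans EfE (le_M E); apply.
have le_G E : (E <= f E)%O -> (E <= G)%O.
  by move=> EfE; apply/lefP => i; apply: (sup_upper_bound (S_sup i)); exists E.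
(* Every post-fixed [E] is below [G], so [E <= f E <= f G]: thus [f G] is an upper bound of the
   post-fixed points. *)
have G_fG : (G <= f G)%O.
  apply/lefP => i; apply: ge_sup; first by case: (S_sup i).
  move=> _ [E /= EfE <-].
  by have /lefP := le_trans EfE (f_mono _ _ (le_G _ EfE)); apply.
exists G; last by move=> E fE; apply: le_G; rewrite fE.
(* Monotonicity makes [f G] post-fixed in turn, whence [f G <= G]. *)
by apply: le_anti; rewrite G_fG le_G //; exact: f_mono.
Qed.

Lemma least_fixpoint (R : realType) (I : Type) (m M : I -> R)
    (f : (I -> R) -> I -> R) :
  (forall E, (m <= f E <= M)%O) -> {homo f : E E' / (E <= E')%O} ->
  exists2 G, f G = G & forall E, f E = E -> (G <= E)%O.
Proof.
move=> f_box f_mono.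
pose opp (E : I -> R) i := - E i.
have oppK E : opp (opp E) = E by apply/funext => i; exact: opprK.
have opp_le E E' : (E <= E')%O -> (opp E' <= opp E)%O.
  by move=> /lefP EE'; apply/lefP => i; rewrite /opp lerN2.
have [||G fG maxG] := @greatest_fixpoint R I (opp M) (opp m) (opp \o f \o opp).
(* Negation swaps the two corners of the box. *)
- by move=> E /=; case/andP: (f_box (opp E)) => ? ?; rewrite !opp_le.
- by move=> E E' EE' /=; apply/opp_le/f_mono/opp_le.
exists (opp G); first by rewrite -[RHS](congr1 opp fG) /= oppK.
move=> E fE; rewrite -[E]oppK; apply/opp_le/maxG.
by rewrite /= oppK fE.
Qed.

Theorem theorem3p1 (R : realType) (n : nat) (n_ge1 : (1 <= n)%N)
    (Ae Le : 'I_n -> R) (A L : 'I_n -> 'I_n -> R)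
    (Ae_ge0 : forall i, 0 <= Ae i) (Le_ge0 : forall i, 0 <= Le i)
    (A_ge0 : forall i j, 0 <= A i j) (L_ge0 : forall i j, 0 <= L i j)
    (AL : forall i j, A j i = L i j)
    (Ve : 'I_n -> ('I_n -> R) -> R) (V : 'I_n -> 'I_n -> ('I_n -> R) -> R)
    (Ve01 : forall i, unit_valued (Ve i))
    (V01 : forall i j, unit_valued (V i j))
    (Ve_mono : forall i, nondecreasing_valuation (Ve i))
    (V_mono : forall i j, nondecreasing_valuation (V i j)) :
  exists Emax Emin : 'I_n -> R,
    [/\ Emax = Phi Ae Le A L Ve V Emax,
        Emin = Phi Ae Le A L Ve V Emin &
        forall E : 'I_n -> R, E = Phi Ae Le A L Ve V E ->
          forall i, Emin i <= E i <= Emax i].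
Proof.
set f := Phi Ae Le A L Ve V.
(* The corners are the equities obtained when all valuations equal 0, respectively 1. *)
pose m i := - Le i - \sum_(j < n) L i j.
pose M i := Ae i - Le i + \sum_(j < n) A i j - \sum_(j < n) L i j.
have f_box E : (m <= f E <= M)%O.
  apply/andP; split; apply/lefP => i; rewrite /f /Phi lerD2r.
    rewrite -[leLHS]addr0 lerD //; last first.
      by apply: sumr_ge0 => j _; case/andP: (V01 i j E) => ? _; exact: mulr_ge0.
    by rewrite lerDr mulr_ge0 //; case/andP: (Ve01 i E).
  apply: lerD; first by rewrite lerD2r ler_piMr //; case/andP: (Ve01 i E).
  by apply: ler_sum => j _; rewrite ler_piMr //; case/andP: (V01 i j E).
(* Only asset terms depend on [E], and their coefficients, being book values, are nonnegative. *)
have f_mono : {homo f : E E' / (E <= E')%O}.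
  move=> E E' EE'; apply/lefP => i; rewrite /f /Phi lerD2r.
  apply: lerD; first by rewrite lerD2r ler_wpM2l //; exact: Ve_mono.
  by apply: ler_sum => j _; rewrite ler_wpM2l //; exact: V_mono.
have [Emax fmax maxP] := greatest_fixpoint _ _ _ _ _ f_box f_mono.
have [Emin fmin minP] := least_fixpoint _ _ _ _ _ f_box f_mono.
exists Emax, Emin; split=> // E /esym fE i.
by move/lefP: (minP _ fE) => ->; move/lefP: (maxP _ fE) => ->.
Qed.
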